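(* Let $n\geq 1$, $C\in \mathrm{Mat}(n,\mathbb C)$, $a=(a_k)_{k=1}^n\in\mathbb C^n$ and $\lambda=(\lambda_k)_{k=1}^n\in\mathbb C^n$, with $\lambda_k\neq 0$ for all $k$. Put $C(\lambda)=\mathrm{diag}(\lambda_1,\dots,\lambda_n)+C$ and $P_C(\lambda)=\det C(\lambda)$, and assume $P_C(\lambda)\neq 0$. Then $$C(\lambda)^{-1}=\frac{1}{P_C(\lambda)}\Big(\prod_{k=1}^n\lambda_k\Big)\sum_{r=1}^n\ \sum_{1\leq i_1<i_2<\dots<i_r\leq n}\frac{A^T(C_{i_1i_2\dots i_r})}{\lambda_{i_1}\lambda_{i_2}\cdots\lambda_{i_r}},$$ where each $A^T(C_{i_1\dots i_r})$ is regarded as an element of $\mathrm{Mat}(n,\mathbb C)$, and $$\big(C(\lambda)^{-1}a,a\big)=\frac{1}{P_C(\lambda)}\Big(\prod_{k=1}^n\lambda_k\Big)\sum_{r=1}^n\ \sum_{1\leq i_1<i_2<\dots<i_r\leq n}\frac{\big(A^T(C_{i_1i_2\dots i_r})a_{i_1i_2\dots i_r},a_{i_1i_2\dots i_r}\big)}{\lambda_{i_1}\lambda_{i_2}\cdots\lambda_{i_r}},$$ or, equivalently, writing $\lambda_\alpha=\prod_{i\in\alpha}\lambda_i$, $$\big(C(\lambda)^{-1}a,a\big)=\frac{1}{P_C(\lambda)}\Big(\prod_{k=1}^n\lambda_k\Big)\sum_{\alpha\subseteq\{1,2,\dots,n\},\ |\alpha|\geq 1}\frac{\big(A^T(C_\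alpha)a_\alpha,a_\alpha\big)}{\lambda_\alpha}.$$
   Context: For $\alpha=\{i_1<i_2<\dots<i_r\}\subseteq\{1,\dots,n\}$, $C_\alpha=C_{i_1i_2\dots i_r}$ denotes the $r\times r$ submatrix of $C$ formed by the entries in rows and columns $i_1,\dots,i_r$, and $a_\alpha=a_{i_1i_2\dots i_r}=(a_{i_1},\dots,a_{i_r})\in\mathbb C^r$. For an $r\times r$ matrix $B$, $A(B)=(A^i_j(B))_{1\leq i,j\leq r}$ is the matrix of its first-order cofactors: $A^i_j(B)$ is $(-1)^{i+j}$ times the determinant of the matrix obtained from $B$ by deleting row $i$ and column $j$. For $r=1$ the convention is $A(C_k)=1$ (the $1\times 1$ matrix $1$). $A^T(B)$ denotes the transpose of $A(B)$ (so $A^T(B)=\det(B)\,B^{-1}$ if $B$ is invertible). When $A^T(C_{i_1\dots i_r})$ is regarded as an element of $\mathrm{Mat}(n,\mathbb C)$, its $(p,q)$ entry is placed at position $(i_p,i_q)$ for $1\leq p,q\leq r$, and all other entries are zero. The pairing is the bilinear one, $(x,y)=\sum_k x_ky_k$ (no complex conjugation). *)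

(* Defs.v *)
From HB Require Import structures.
From mathcomp Require Import all_boot all_order all_algebra.
From mathcomp Require Import reals complex.

Set Implicit Arguments.
Unset Strict Implicit.
Unset Printing Implicit Defensive.

Import GRing.Theory.
Local Open Scope ring_scope.

Definition increasing (n r : nat) (t : r.-tuple 'I_n) : bool :=
  sorted ltn (map val t).

(* The indices i_1 < ... < i_r of alpha; [enum] on a set of ordinals lists its
   elements in increasing order. *)
Definition indices (n : nat) (alpha : {set 'I_n}) : #|alpha|.-tuple 'I_n :=
  enum_tuple alpha.

Section MatrixNotions.
Context {F : fieldType}.

Definition sub_matrix (n r : nat) (C : 'M[F]_n) (t : r.-tuple 'I_n) : 'M[F]_r :=
  mxsub (tnth t) (tnth t) C.

Definition sub_vector (n r : nat) (a : 'cV[F]_n) (t : r.-tuple 'I_n) :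
    'cV[F]_r :=
  \col_p a (tnth t p) 0.

(* For r = 1 this is the 1 x 1 matrix 1, since a 0 x 0 determinant is 1. *)
Definition cofactor_matrix (r : nat) (B : 'M[F]_r) : 'M[F]_r :=
  \matrix_(i, j) cofactor B i j.

(* B is regarded as an n x n matrix: B p q goes to position (t_p, t_q), all
   other entries are 0. The positions are distinct when t has no repetition,
   in particular when t is increasing. *)
Definition embed_matrix (n r : nat) (t : r.-tuple 'I_n) (B : 'M[F]_r) :
    'M[F]_n :=
  \sum_p \sum_q B p q *: delta_mx (tnth t p) (tnth t q).

(* Bilinear: no complex conjugation. *)
Definition pairing (n : nat) (x y : 'cV[F]_n) : F :=
  \sum_k x k 0 * y k 0.

Definition C_lambda (n : nat) (C : 'M[F]_n) (lambda : 'cV[F]_n) : 'M[F]_n :=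
  diag_mx lambda^T + C.

Definition P_C (n : nat) (C : 'M[F]_n) (lambda : 'cV[F]_n) : F :=
  \det (C_lambda C lambda).

End MatrixNotions.

(* Main.v *)
(* Expanding det (diag d + C) along the choices of a diagonal entry or an entry
   of C in each row gives the sum over alpha of
   (prod of the d_i outside alpha) * det C_alpha. Since
   det (A + E_ji) - det A is the (j, i) cofactor of A, i.e. the (i, j) entry of
   the adjugate, the difference of this expansion at C + E_ji and at C expresses
   the adjugate of diag d + C by the adjugates of the C_alpha. *)

Require Import Defs.
From HB Require Import structures.
From mathcomp Require Import all_boot all_order all_algebra.
From mathcomp Require Import reals complex.

Set Implicit Arguments.
Unset Strict Implicit.
Unset Printing Implicit Defensive.

Import GRing.Theory.
Local Open Scope ring_scope.
Local Open Scope complex_scope.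

(** * Determinants under low-rank perturbations *)

Section Determinants.
Context {R : comNzRingType}.

(** Sylvester's identity. Multiplying [M] by the same unitriangular block matrix, on the left or on
    the right, clears the upper right block and leaves one of the two sums on the diagonal; both
    products have determinant [\det M]. *)
Lemma det_add_mulmxC (m n : nat) (A : 'M[R]_(m, n)) (B : 'M[R]_(n, m)) :
  \det (1%:M + A *m B) = \det (1%:M + B *m A).
Proof.
pose M := block_mx 1%:M (- A) B 1%:M.
have /(congr1 determinant) : block_mx 1%:M A 0 1%:M *m M =
    block_mx (1%:M + A *m B) 0 B 1%:M.
  by rewrite mulmx_block !mul1mx !mul0mx mulmx1 addNr !add0r.
have /(congr1 determinant) : M *m block_mx 1%:M A 0 1%:M =
    block_mx 1%:M 0 B (1%:M + B *m A).
  by rewrite mulmx_block !mulmx1 !mulmx0 mul1mx subrr !addr0 addrC.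
by rewrite !det_mulmx det_ublock !det_lblock !det1 !mulr1 !mul1r => -> ->.
Qed.

(** Laplace expansion along row [i]: the perturbation lies in that row, so the cofactors of the row
    do not see it. *)
Lemma det_add_delta_mx (n : nat) (A : 'M[R]_n) (i j : 'I_n) :
  \det (A + delta_mx i j) = \det A + cofactor A i j.
Proof.
have cof k : cofactor (A + delta_mx i j) i k = cofactor A i k.
  congr (_ * \det _); apply/matrixP=> p q; rewrite !mxE.
  by rewrite eq_sym (negPf (neq_lift _ _)) addr0.
rewrite (expand_det_row _ i) (expand_det_row A i).
under eq_bigr => k _ do rewrite cof !mxE eqxx /= mulrDl.
rewrite big_split /=; congr (_ + _).
rewrite (bigD1 j) //= eqxx mul1r big1 ?addr0 // => k /negPf->.
by rewrite mul0r.
Qed.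

End Determinants.

Section PrincipalMinors.
Context {F : fieldType} {n : nat}.
Implicit Types (C : 'M[F]_n) (d a : 'cV[F]_n) (alpha : {set 'I_n}).

(** * Principal submatrices and their embedding *)

Lemma sub_matrixD r C D (t : r.-tuple 'I_n) :
  sub_matrix (C + D) t = sub_matrix C t + sub_matrix D t.
Proof. by apply/matrixP=> p q; rewrite !mxE. Qed.

Lemma tnth_eqE r (t : r.-tuple 'I_n) : uniq t ->
  forall p q : 'I_r, (tnth t p == tnth t q) = (p == q).
Proof. by move=> /tuple_uniqP t_inj p q; apply: inj_eq. Qed.

Lemma sub_delta_mx r (t : r.-tuple 'I_n) (p q : 'I_r) : uniq t ->
  sub_matrix (delta_mx (tnth t p) (tnth t q)) t = delta_mx p q :> 'M[F]_r.
Proof. by move=> Ut; apply/matrixP=> x y; rewrite !mxE !tnth_eqE. Qed.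

Lemma sub_delta_mx0 r (t : r.-tuple 'I_n) (i j : 'I_n) :
  ~~ ((i \in t) && (j \in t)) -> sub_matrix (delta_mx i j) t = 0 :> 'M[F]_r.
Proof.
move=> ij_t; apply/matrixP=> x y; rewrite !mxE.
case: eqP => // xi; case: eqP => // yj; case/negP: ij_t.
by rewrite -xi -yj !mem_tnth.
Qed.

Lemma embed_matrixE r (t : r.-tuple 'I_n) (B : 'M[F]_r) (i j : 'I_n) :
  embed_matrix t B i j =
    \sum_p \sum_q B p q * ((i == tnth t p) && (j == tnth t q))%:R.
Proof.
rewrite /embed_matrix summxE; apply: eq_bigr => p _.
by rewrite summxE; apply: eq_bigr => q _; rewrite !mxE.
Qed.

Lemma embed_matrix_tnth r (t : r.-tuple 'I_n) (B : 'M[F]_r) (p q : 'I_r) :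
  uniq t -> embed_matrix t B (tnth t p) (tnth t q) = B p q.
Proof.
move=> Ut; rewrite embed_matrixE (bigD1 p) //= (bigD1 q) //= !eqxx mulr1.
rewrite !big1 ?addr0 // => [x xp|y yq].
  by rewrite big1 // => y _; rewrite tnth_eqE // eq_sym (negPf xp) mulr0.
by rewrite tnth_eqE // eq_sym (negPf yq) mulr0.
Qed.

Lemma embed_matrix_notin r (t : r.-tuple 'I_n) (B : 'M[F]_r) (i j : 'I_n) :
  ~~ ((i \in t) && (j \in t)) -> embed_matrix t B i j = 0.
Proof.
move=> ij_t; rewrite embed_matrixE big1 // => p _; rewrite big1 // => q _.
case: eqP => [ip|]; last by rewrite mulr0.
case: eqP => [jq|]; last by rewrite mulr0.
by case/negP: ij_t; rewrite ip jq !mem_tnth.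
Qed.

(** This covers all positions at once: when [i] and [j] both occur in [t], the perturbation
    restricts to a matrix unit and yields a cofactor; otherwise it restricts to 0, as does the
    embedded entry. *)
Lemma embed_cofactor_matrix r C (t : r.-tuple 'I_n) (i j : 'I_n) : uniq t ->
  embed_matrix t (cofactor_matrix (sub_matrix C t))^T i j =
    \det (sub_matrix (C + delta_mx j i) t) - \det (sub_matrix C t).
Proof.
move=> Ut; rewrite sub_matrixD.
have [/andP[/tnthP[p ->] /tnthP[q ->]]|ij_t] := boolP ((i \in t) && (j \in t)).
  rewrite embed_matrix_tnth // sub_delta_mx // det_add_delta_mx !mxE.
  by rewrite addrC addKr.
by rewrite embed_matrix_notin // sub_delta_mx0 1?andbC // addr0 subrr.
Qed.

(* With E the r x n matrix selecting the rows t, the left-hand matrix is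
   1 + E^T (E C - E), while C_t - 1 = (E C - E) E^T. *)
Lemma det_sub_matrix r C (t : r.-tuple 'I_n) : uniq t ->
  \det (\matrix_(i, j) (if i \in t then C i j else (i == j)%:R)) =
    \det (sub_matrix C t).
Proof.
move=> Ut; pose E : 'M[F]_(r, n) := rowsub (tnth t) 1%:M.
have -> : \matrix_(i, j) (if i \in t then C i j else (i == j)%:R) =
    1%:M + E^T *m (E *m (C - 1%:M)).
  apply/matrixP=> i j; rewrite mul_rowsub_mx mul1mx !mxE.
  under eq_bigr => p _ do rewrite !mxE.
  have [/tnthP[p ->]|ti] := boolP (i \in t).
    rewrite (bigD1 p) //= eqxx mul1r big1 ?addr0 => [|q qp].
      by rewrite addrC subrK.
    by rewrite tnth_eqE // (negPf qp) mul0r.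
  rewrite big1 ?addr0 // => p _; case: eqP => [ip|]; last by rewrite mul0r.
  by case/negP: ti; rewrite -ip mem_tnth.
rewrite det_add_mulmxC; congr (\det _); apply/matrixP=> p q.
rewrite mul_rowsub_mx mul1mx !mxE.
under eq_bigr => k _ do rewrite !mxE.
rewrite (bigD1 (tnth t q)) //= eqxx mulr1 big1 ?addr0 => [|k kq].
  by rewrite tnth_eqE // addrC subrK.
by rewrite [tnth t q == k]eq_sym (negPf kq) mulr0.
Qed.

(** * Expansion of the determinant, the adjugate and the inverse over subsets *)

Lemma mem_indices alpha : indices alpha =i alpha.
Proof. by move=> i; rewrite mem_enum. Qed.

Lemma indices_uniq alpha : uniq (indices alpha).
Proof. exact: enum_uniq. Qed.

Lemma det_C_lambda C d :
  \det (C_lambda C d) = \sum_(alpha : {set 'I_n})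
    (\prod_(i in ~: alpha) d i 0) * \det (sub_matrix C (indices alpha)).
Proof.
have expand s : \prod_i C_lambda C d i (perm.fun_of_perm s i) =
    \sum_(alpha : {set 'I_n}) \prod_i (if i \in alpha
      then C i (perm.fun_of_perm s i)
      else d i 0 *+ (i == perm.fun_of_perm s i)).
  by rewrite -bigA_distr; apply: eq_bigr => i _; rewrite !mxE addrC.
rewrite {1}/determinant; under eq_bigr => s _ do rewrite expand mulr_sumr.
rewrite exchange_big /=; apply: eq_bigr => alpha _.
(* For fixed [alpha], the sum over [s] is the Leibniz formula for the matrix of [det_sub_matrix]
   with each row [i] outside [alpha] scaled by [d i 0]. *)
rewrite -(det_sub_matrix C (indices_uniq alpha)) mulr_sumr; apply: eq_bigr => s _.
rewrite mulrCA; congr (_ * _).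
rewrite [X in _ = X * _]big_mkcond -big_split /=; apply: eq_bigr => i _.
rewrite !mxE mem_indices inE; case: ifP => _; first by rewrite mul1r.
by rewrite mulr_natr.
Qed.

Lemma adj_C_lambda C d :
  \adj (C_lambda C d) = \sum_(alpha : {set 'I_n})
    (\prod_(i in ~: alpha) d i 0) *:
      embed_matrix (indices alpha)
        (cofactor_matrix (sub_matrix C (indices alpha)))^T.
Proof.
apply/matrixP=> i j; rewrite summxE mxE.
have -> : cofactor (C_lambda C d) j i =
    \det (C_lambda (C + delta_mx j i) d) - \det (C_lambda C d).
  by rewrite /C_lambda addrA det_add_delta_mx [RHS]addrC addKr.
(* The weights depend on [d] only, so the two expansions are subtracted term by term. *)
rewrite !det_C_lambda -sumrB; apply: eq_bigr => alpha _.
by rewrite mxE embed_cofactor_matrix ?indices_uniq // mulrBr.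
Qed.

Lemma embed_matrix0 (t : 0.-tuple 'I_n) (B : 'M[F]_0) : embed_matrix t B = 0.
Proof. by rewrite /embed_matrix big_ord0. Qed.

Lemma invmx_C_lambda C d : (forall k, d k 0 != 0) -> P_C C d != 0 ->
  invmx (C_lambda C d) =
    ((P_C C d)^-1 * \prod_k d k 0) *:
      \sum_(alpha : {set 'I_n} | (1 <= #|alpha|)%N)
        (\prod_(p < #|alpha|) d (tnth (indices alpha) p) 0)^-1 *:
          embed_matrix (indices alpha)
            (cofactor_matrix (sub_matrix C (indices alpha)))^T.
Proof.
move=> d_neq0 P_neq0; rewrite /invmx unitmxE unitfE [\det _ == 0](negPf P_neq0).
rewrite -/(P_C C d) -scalerA adj_C_lambda; congr (_ *: _).
rewrite scaler_sumr [RHS]big_mkcond; apply: eq_bigr => alpha _.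
have [|alpha0] := ifPn; last first.
  (* The term of the empty set vanishes. Generalizing over [r] allows a case analysis that the
     dependent type on [#|alpha|] would block. *)
  suff -> : forall r (t : r.-tuple 'I_n) B, ~~ (0 < r)%N ->
      embed_matrix t B = 0 :> 'M[F]_n by rewrite ?scaler0.
  by case=> // t B _; apply: embed_matrix0.
move=> _; rewrite scalerA; congr (_ *: _).
rewrite -(big_tuple _ _ _ xpredT (fun i => d i 0)) big_enum /=.
(* The full product splits into the factors inside and outside [alpha]; dividing by the former
   leaves the weight over the complement. *)
rewrite [X in _ = X / _](bigID (mem alpha)) /= mulrAC divff ?mul1r; last first.
  by apply/prodf_neq0.
by apply: eq_bigl => i; rewrite inE.
Qed.

(** * Increasing tuples as subsets *)

Lemma increasingE r (t : r.-tuple 'I_n) :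
  increasing t = (enum [set x in t] == t).
Proof.
have sorted_enum (A : {set 'I_n}) : sorted ltn (map val (enum A)).
  rewrite sorted_map; apply: sorted_filter => [? ? ?|]; first exact: ltn_trans.
  by rewrite -sorted_map -enumT val_enum_ord iota_ltn_sorted.
apply/idP/eqP => [t_incr|et]; last first.
  by rewrite /increasing -et; apply: sorted_enum.
(* Two strictly increasing sequences with the same elements are equal. *)
apply: (inj_map val_inj); apply: (irr_sorted_eq ltn_trans ltnn) => // i.
by apply: eq_mem_map => x; rewrite mem_enum inE.
Qed.

Lemma sum_increasing (V : nmodType) (f : forall r, r.-tuple 'I_n -> V) :
  \sum_(1 <= r < n.+1) \sum_(t : r.-tuple 'I_n | increasing t) f r t =
    \sum_(alpha : {set 'I_n} | (1 <= #|alpha|)%N) f _ (indices alpha).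
Proof.
transitivity (\sum_(1 <= r < n.+1) \sum_(alpha : {set 'I_n} | #|alpha| == r)
    f _ (indices alpha)).
  apply: eq_bigr => r _.
  (* [indices alpha] has length [#|alpha|], which equals [r] only propositionally, so values of [f]
     are compared through the underlying sequences. *)
  have f_val r' (u : r'.-tuple 'I_n) (t : r.-tuple 'I_n) :
      tval u = t -> f r' u = f r t.
    move=> ut; have rr' : r' = r by rewrite -(size_tuple u) ut size_tuple.
    by subst r'; congr (f r _); apply: val_inj.
  rewrite [RHS](reindex_omap (fun t : r.-tuple 'I_n => [set x in t])
    (fun alpha => insub (enum alpha))) /=; last first.
    move=> alpha; rewrite cardE => alpha_r; rewrite insubT /=.
    by congr Some; apply/setP=> x; rewrite inE mem_enum.
  apply: eq_big => t; last by rewrite increasingE => /eqP /f_val->.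
  rewrite increasingE; apply/eqP/andP => [et|[_ /eqP]].
    by rewrite cardE et size_tuple valK.
  by case: insubP => //= u _ <- [->].
under eq_bigr => r _ do rewrite big_mkcond.
rewrite exchange_big [RHS]big_mkcond; apply: eq_bigr => alpha _ /=.
(* Only [r = #|alpha|] contributes; since [#|alpha| <= n], it lies in the range exactly when [alpha]
   is nonempty. *)
rewrite -big_mkcond /= (eq_bigl (pred1 #|alpha|)) => [|r]; last exact: eq_sym.
rewrite big_nat1_eq /= ltnS.
by have := max_card (mem alpha); rewrite card_ord => ->; rewrite andbT.
Qed.

(** * The quadratic form *)

Lemma pairing_embed_matrix r (t : r.-tuple 'I_n) (B : 'M[F]_r) a :
  pairing (embed_matrix t B *m a) a =
    pairing (B *m sub_vector a t) (sub_vector a t).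
Proof.
rewrite /pairing /embed_matrix mulmx_suml.
under eq_bigr => k _ do rewrite summxE mulr_suml.
rewrite exchange_big; apply: eq_bigr => p _ /=.
under eq_bigr => k _ do rewrite mulmx_suml summxE mulr_suml.
rewrite exchange_big !mxE mulr_suml; apply: eq_bigr => q _ /=.
(* A single matrix unit is left: only its row [tnth t p] and column [tnth t q] contribute. *)
rewrite (bigD1 (tnth t p)) //= big1 ?addr0 => [|k kp].
  rewrite -scalemxAl !mxE (bigD1 (tnth t q)) //= !mxE !eqxx mul1r.
  by rewrite big1 ?addr0 // => k /negPf kq; rewrite !mxE kq andbF mul0r.
rewrite -scalemxAl !mxE big1 ?mulr0 ?mul0r // => l _.
by rewrite !mxE (negPf kp) mul0r.
Qed.

Lemma pairingZl (c : F) (x y : 'cV[F]_n) :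
  pairing (c *: x) y = c * pairing x y.
Proof.
by rewrite /pairing mulr_sumr; apply: eq_bigr => k _; rewrite !mxE mulrA.
Qed.

Lemma pairing_suml (I : Type) (s : seq I) (P : pred I) (x : I -> 'cV[F]_n)
    (y : 'cV[F]_n) :
  pairing (\sum_(i <- s | P i) x i) y = \sum_(i <- s | P i) pairing (x i) y.
Proof.
by rewrite exchange_big; apply: eq_bigr => k _; rewrite summxE mulr_suml.
Qed.

Lemma pairing_invmx_C_lambda C a d : (forall k, d k 0 != 0) -> P_C C d != 0 ->
  pairing (invmx (C_lambda C d) *m a) a =
    (P_C C d)^-1 * (\prod_k d k 0) *
      \sum_(alpha : {set 'I_n} | (1 <= #|alpha|)%N)
        pairing ((cofactor_matrix (sub_matrix C (indices alpha)))^T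
                   *m sub_vector a (indices alpha))
                (sub_vector a (indices alpha))
        / \prod_(p < #|alpha|) d (tnth (indices alpha) p) 0.
Proof.
move=> d_neq0 P_neq0; rewrite invmx_C_lambda // -scalemxAl pairingZl.
rewrite mulmx_suml pairing_suml; congr (_ * _); apply: eq_bigr => alpha _.
by rewrite -scalemxAl pairingZl pairing_embed_matrix mulrC.
Qed.

End PrincipalMinors.

Theorem theorem5p1 (R : realType) (n : nat) (hn : (1 <= n)%N)
    (C : 'M[R[i]]_n) (a lambda : 'cV[R[i]]_n)
    (hlambda : forall k : 'I_n, lambda k 0 != 0)
    (hP : P_C C lambda != 0) :
  [/\ invmx (C_lambda C lambda) =
        ((P_C C lambda)^-1 * \prod_(k < n) lambda k 0) *:
          \sum_(1 <= r < n.+1) \sum_(t : r.-tuple 'I_n | increasing t)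
            (\prod_(p < r) lambda (tnth t p) 0)^-1 *:
              embed_matrix t (cofactor_matrix (sub_matrix C t))^T,
      pairing (invmx (C_lambda C lambda) *m a) a =
        (P_C C lambda)^-1 * (\prod_(k < n) lambda k 0) *
          \sum_(1 <= r < n.+1) \sum_(t : r.-tuple 'I_n | increasing t)
            pairing ((cofactor_matrix (sub_matrix C t))^T *m sub_vector a t)
                    (sub_vector a t)
            / \prod_(p < r) lambda (tnth t p) 0
    & pairing (invmx (C_lambda C lambda) *m a) a =
        (P_C C lambda)^-1 * (\prod_(k < n) lambda k 0) *
          \sum_(alpha : {set 'I_n} | (1 <= #|alpha|)%N)
            pairing ((cofactor_matrix (sub_matrix C (indices alpha)))^T
                       *m sub_vector a (indices alpha))
                    (sub_vector a (indices alpha))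
            / \prod_(k in alpha) lambda k 0].
Proof.
split.
- rewrite (sum_increasing (fun r t => (\prod_(p < r) lambda (tnth t p) 0)^-1 *:
    embed_matrix t (cofactor_matrix (sub_matrix C t))^T)).
  exact: invmx_C_lambda.
- rewrite (sum_increasing (fun r t =>
    pairing ((cofactor_matrix (sub_matrix C t))^T *m sub_vector a t)
      (sub_vector a t) / \prod_(p < r) lambda (tnth t p) 0)).
  exact: pairing_invmx_C_lambda.
rewrite pairing_invmx_C_lambda //; congr (_ * _); apply: eq_bigr => alpha _.
(* The third formula differs from the lemma only in indexing the denominator by the set instead of
   by its enumeration. *)
by rewrite -(big_tuple _ _ _ xpredT (fun i => lambda i 0)) big_enum.
Qed.
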